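(* Assume (C1)–(C8) (as listed in the context). Assume that one of the following conditions holds: (1) $f(t,u)<m_S|u|$ for every $t\in[0,1]$ and $u\in\mathbb R\setminus\{0\}$; (2) $f(t,u)>M_S\,u$ for every $t\in[a,b]$ and $u\in\mathbb R^+=(0,\infty)$. Then the equations $$u(t)=\gamma(t)\alpha[u]+\delta(t)\beta[u]+\int_0^1 k(t,s)g(s)f(s,u(s))\,ds,\quad t\in[0,1],$$ and $$u(t)=\int_0^1k_S(t,s)g(s)f(s,u(s))\,ds,\quad t\in[0,1],$$ have no non-trivial solution in $K$.
   Context: $C[0,1]$ is the space of continuous real functions on $[0,1]$ with norm $\|w\|=\max_{t\in[0,1]}|w(t)|$. Given are $k$, $g$, $f$, $\gamma$, $\delta$, $A$, $B$, and $\alpha[u]=\int_0^1u(s)\,dA(s)$, $\beta[u]=\int_0^1u(s)\,dB(s)$ (Stieltjes integrals). Assumptions: (C1) $k:[0,1]\times[0,1]\to\mathbb R$ is measurable, and for every $\tau\in[0,1]$, $\lim_{t\to\tau}|k(t,s)-k(\tau,s)|=0$ for almost every $s\in[0,1]$. (C2) There exist a subinterval $[a,b]\subseteq[0,1]$, a function $\Phi\in L^\infty[0,1]$ and a constant $c_1\in(0,1]$ such that $|k(t,s)|\le\Phi(s)$ for $t\in[0,1]$ and a.e. $s\in[0,1]$, and $k(t,s)\ge c_1\Phi(s)$ for $t\in[a,b]$ and a.e. $s\in[0,1]$. (C3) $g\,\Phi\in L^1[0,1]$, $g(s)\ge0$ for a.e. $s\in[0,1]$, and $\int_a^b\Phi(s)g(s)\,ds>0$.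 (C4) $f:[0,1]\times\mathbb R\to[0,\infty)$ satisfies Carathéodory conditions: $f(\cdot,u)$ is measurable for each fixed $u$, $f(t,\cdot)$ is continuous for a.e. $t$, and for each $r>0$ there is $\phi_r\in L^\infty[0,1]$ with $f(t,u)\le\phi_r(t)$ for all $u\in[-r,r]$ and a.e. $t\in[0,1]$. (C5) $A,B$ are functions of bounded variation and $\mathcal K_A(s):=\int_0^1k(t,s)\,dA(t)\ge0$, $\mathcal K_B(s):=\int_0^1k(t,s)\,dB(t)\ge0$ for a.e. $s\in[0,1]$. (C6) $\gamma\in C[0,1]$, $0\le\alpha[\gamma]<1$, $\beta[\gamma]\ge0$, and there is $c_2\in(0,1]$ with $\gamma(t)\ge c_2\|\gamma\|$ for $t\in[a,b]$. (C7) $\delta\in C[0,1]$, $0\le\beta[\delta]<1$, $\alpha[\delta]\ge0$, and there is $c_3\in(0,1]$ with $\delta(t)\ge c_3\|\delta\|$ for $t\in[a,b]$. (C8) $D:=(1-\alpha[\gamma])(1-\beta[\delta])-\alpha[\delta]\beta[\gamma]>0$. Let $c=\min\{c_1,c_2,c_3\}$ and let $K$ be the cone $$K=\{u\in C[0,1]:\ \min_{t\in[a,b]}u(t)\ge c\|u\|,\ \alpha[u]\ge0,\ \beta[u]\ge0\}.$$ The kernel $k_S$ is $$k_S(t,s)=\tfrac{\gamma(t)}{D}\big[(1-\beta[\delta])\mathcal K_A(s)+\alpha[\delta]\mathcal K_B(s)\big]+\tfrac{\delta(t)}{D}\big[\beta[\gamma]\mathcal K_A(s)+(1-\alpha[\gamma])\mathcal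 K_B(s)\big]+k(t,s),$$ with $k_S^+=\max\{k_S,0\}$, $k_S^-=\max\{-k_S,0\}$. The constants $m_S,M_S$ are defined by $$\frac1{m_S}=\sup_{t\in[0,1]}\max\Big\{\int_0^1k_S^+(t,s)g(s)\,ds,\int_0^1k_S^-(t,s)g(s)\,ds\Big\},\qquad \frac1{M_S}=\inf_{t\in[a,b]}\int_a^bk_S(t,s)g(s)\,ds.$$ *)

(* Defs.v *)
From HB Require Import structures.
From mathcomp Require Import all_boot all_order all_algebra.
From mathcomp Require Import all_classical all_reals all_analysis.
From mathcomp Require Import measurable_realfun.

Set Implicit Arguments.
Unset Strict Implicit.
Unset Printing Implicit Defensive.

Import Order.TTheory GRing.Theory Num.Theory.
Import numFieldNormedType.Exports.

Local Open Scope classical_set_scope.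
Local Open Scope ring_scope.

(* A function on [0,1] is represented by a total function R -> R, of which only
   the values on [0,1] matter. *)
Notation I01 := (`[0, 1]%classic).

(* Lebesgue measure on the completed (Lebesgue) sigma-algebra; the carrier of
   its measurableType is convertible to R. *)
Notation leb := (@completed_lebesgue_measure _).

Definition LebR (R : realType) :=
  caratheodory_type ((wlength (@idfun R))^*)%mu.

Definition ae01 (R : realType) (P : R -> Prop) : Prop :=
  {ae @completed_lebesgue_measure R, forall s, I01 s -> P s}.

Definition Lmeasurable01 (R : realType) (h : R -> R) : Prop :=
  measurable_fun (I01 : set (LebR R)) (h : LebR R -> R).

(* The library's product measure lives on the product sigma-algebra, which is
   not complete; its completion is the Lebesgue sigma-algebra of the plane. *)
Definition Lmeasurable01x01 (R : realType) (k : R -> R -> R) : Prop :=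
  let leb2 := (@completed_lebesgue_measure R \x
               @completed_lebesgue_measure R)%E in
  measurable_fun
    (I01 `*` I01 : set (g_sigma_algebraType (completed_algebra_gen leb2)))
    (fun p => k p.1 p.2).

(* The extension by 0 to R of h : [0,1] -> R is in L^oo(R). *)
Definition Linfty01 (R : realType) (h : R -> R) : Prop :=
  (h \_ I01 : LebR R -> R) \in Lfun (@completed_lebesgue_measure R) +oo%E.

Definition C01 (R : realType) (w : R -> R) : Prop :=
  {within I01, continuous w}.

Definition norm01 (R : realType) (w : R -> R) : R :=
  sup [set `|w t| | t in I01].

(* Sum of h(xi_i) (F(x_{i+1}) - F(x_i)) over the partition
   a = x_0 < x_1 < ... < x_n = b, where s = [:: x_1; ...; x_n]. *)
Definition RS_sum (R : realType) (h F : R -> R) (a b : R) (s : seq R)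
    (xi : nat -> R) : R :=
  let x := nth b (a :: s) in
  \sum_(0 <= i < size s) h (xi i) * (F (x i.+1) - F (x i)).

(* Riemann-Stieltjes integral: limit of the sums as the mesh tends to 0. *)
Definition is_RS (R : realType) (h F : R -> R) (a b l : R) : Prop :=
  forall e : R, 0 < e -> exists2 d : R, 0 < d &
    forall (s : seq R) (xi : nat -> R),
      let x := nth b (a :: s) in
      itv_partition a b s ->
      (forall i, (i < size s)%N ->
         x i <= xi i <= x i.+1 /\ x i.+1 - x i < d) ->
      `|RS_sum h F a b s xi - l| < e.

Definition RS_integrable01 (R : realType) (h F : R -> R) : Prop :=
  exists l, is_RS h F 0 1 l.

(* The value of int_0^1 h dF; it is 0 by convention if the integral does not
   exist. *)
Definition RS01 (R : realType) (h F : R -> R) : R :=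
  xget 0 [set l | is_RS h F 0 1 l].

Definition caratheodory (R : realType) (f : R -> R -> R) : Prop :=
  [/\ forall u, Lmeasurable01 (f ^~ u),
      ae01 (fun t => continuous (f t)) &
      forall r, 0 < r -> exists2 phi : R -> R, Linfty01 phi &
        forall u, -r <= u <= r -> ae01 (fun t => f t u <= phi t)].

Section Problem.
Context {R : realType}.
Implicit Types (k f : R -> R -> R) (g A B gam del u : R -> R) (a b c : R).

Definition calK k A (s : R) : R := RS01 (k ^~ s) A.

Definition detD A B gam del : R :=
  (1 - RS01 gam A) * (1 - RS01 del B) - RS01 del A * RS01 gam B.

Definition kS k A B gam del (t s : R) : R :=
  gam t / detD A B gam del *
    ((1 - RS01 del B) * calK k A s + RS01 del A * calK k B s) +
  del t / detD A B gam del *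
    (RS01 gam B * calK k A s + (1 - RS01 gam A) * calK k B s) +
  k t s.

Definition mS k g A B gam del : R :=
  (sup [set Num.max
         (\int[leb]_(s in I01) (Num.max (kS k A B gam del t s) 0 * g s))
         (\int[leb]_(s in I01) (Num.max (- kS k A B gam del t s) 0 * g s))
       | t in I01])^-1.

Definition MS k g A B gam del a b : R :=
  (inf [set \int[leb]_(s in `[a, b]) (kS k A B gam del t s * g s)
       | t in `[a, b]])^-1.

Definition coneK A B a b c u : Prop :=
  [/\ C01 u, c * norm01 u <= inf [set u t | t in `[a, b]],
      0 <= RS01 u A & 0 <= RS01 u B].

Definition solves_perturbed k g f A B gam del u : Prop :=
  forall t, I01 t ->
    u t = gam t * RS01 u A + del t * RS01 u B +
          \int[leb]_(s in I01) (k t s * g s * f s (u s)).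

Definition solves_kS k g f A B gam del u : Prop :=
  forall t, I01 t ->
    u t = \int[leb]_(s in I01) (kS k A B gam del t s * g s * f s (u s)).

Definition nontrivial01 u : Prop := exists2 t, I01 t & u t != 0.

End Problem.

(* Main.v *)
Require Import Defs.
From HB Require Import structures.
From mathcomp Require Import all_boot all_order all_algebra.
From mathcomp Require Import all_classical all_reals all_analysis.
From mathcomp Require Import measurable_realfun ess_sup_inf hoelder ring lra.

Set Implicit Arguments.
Unset Strict Implicit.
Unset Printing Implicit Defensive.

Import Order.TTheory GRing.Theory Num.Theory.
Import numFieldNormedType.Exports.

Local Open Scope classical_set_scope.
Local Open Scope ring_scope.

(** The perturbed equation reduces to the equation with kernel [kS]. Applying
    alpha and beta to it gives a linear system for alpha[u] and beta[u] whose
    determinant is positive; its solution turns the two boundary terms into the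
    terms by which [kS] differs from [k] ([solves_perturbed_kS]).

    Let then u be a nontrivial solution of the equation with kernel [kS], lying
    in the cone. If f(t, u) < m |u|, evaluate the equation where |u| attains its
    maximum N: since f(s, u(s)) < m N almost everywhere, the positive and the
    negative part of the kernel each contribute less than m N / m = N, which is
    absurd ([not_solution_sublinear]). If f(t, u) > M u on [a, b], evaluate it
    where u attains its minimum over [a, b]: this minimum is positive by the
    definition of the cone, and the integral over [a, b] alone exceeds it
    ([not_solution_superlinear]). Both arguments turn a strict inequality
    between integrands into one between integrals, which is possible unless the
    weight vanishes almost everywhere ([ae_weighted_Rintegral_lt]).

    The remaining work is to give the integrals a meaning and to exchange them.
    Every kernel section is measurable and almost everywhere at most a multiple
    of [Phi] ([dominated01]), which makes its product with g(s) f(s, u(s))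
    integrable although [g] itself may fail to be measurable
    ([dominated01_integrable]). Continuous functions are Stieltjes integrable
    against functions of bounded variation ([RS_integrable_continuous]), so that
    alpha and beta are limits of sums over uniform partitions; dominated
    convergence along these sums exchanges alpha or beta with the Lebesgue
    integral ([RS01_Rintegral]). *)

(** * Riemann-Stieltjes integrals of continuous functions *)

Section RS.
Context {R : realType}.
Implicit Types (h F V u : R -> R).

Lemma within_continuous_dist h (D : set R) x :
  {within D, continuous h} -> D x ->
  forall e : R, 0 < e -> exists2 d : R, 0 < d &
    forall y, D y -> `|x - y| < d -> `|h x - h y| < e.
Proof.
move=> /subspace_continuousP hc Dx e e0.
have /cvgrPdist_lt /(_ e e0) := hc x Dx.
rewrite near_withinE => -[d /= d0 dP]; exists d => // y Dy xy.
exact: dP.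
Qed.

(** Compactness enters as a covering property of the filter of moduli near
    [0^+]. The covering also quantifies over points near [a, b] but outside it,
    so membership in [a, b] is part of the covering predicate. *)
Lemma segment_uniform_continuous h (a b : R) :
  {within `[a, b], continuous h} ->
  forall e : R, 0 < e -> exists2 d : R, 0 < d &
    forall x y, `[a, b]%classic x -> `[a, b]%classic y ->
      `|x - y| < d -> `|h x - h y| < e.
Proof.
move=> hc e e0.
have /compact_near_coveringP cvr := @segment_compact R a b.
pose P (d x : R) := forall y, `[a, b]%classic x -> `[a, b]%classic y ->
  `|x - y| < d -> `|h x - h y| < e.
have : \forall d \near 0^'+, `[a, b]%classic `<=` P d.
  apply: cvr => x abx.
  have e20 : 0 < e / 2 by rewrite divr_gt0.
  have [r r0 rP] := within_continuous_dist hc abx e20.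
  have r20 : 0 < r / 2 by rewrite divr_gt0.
  near=> x' d => y abx' aby x'y.
  have xx' : `|x - x'| < r / 2.
    by near: x'; exact: (nbhsx_ballx x (r / 2) r20).
  have dr : d < r / 2 by near: d; exact: nbhs_right_lt.
  rewrite (splitr e) (le_lt_trans (ler_distD (h x) _ _))// ltrD//.
    by rewrite distrC rP// (lt_trans xx')// ltr_pdivrMr// ltr_pMr// ltr1n.
  rewrite rP// (splitr r) (le_lt_trans (ler_distD x' _ _))// ltrD//.
  exact: lt_trans dr.
move=> H.
near (0 : R)^'+ => d.
exists d; first by near: d; exact: nbhs_right_gt.
move=> x y abx aby xy.
have : `[a, b]%classic `<=` P d by near: d.
by move=> /(_ x abx y abx aby); exact.
Unshelve. all: by end_near. Qed.

(** The control function is the total variation of [F] on [a, x]. Bounding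
    increments by differences of one function makes estimates along a partition
    telescope. *)
Lemma bounded_variation_increment F (a b : R) :
  a <= b -> bounded_variation a b F ->
  exists V, forall x y, a <= x -> x <= y -> y <= b ->
    `|F y - F x| <= V y - V x.
Proof.
move=> ab /(bounded_variationP _ ab) Ffin.
exists (fun x => fine (total_variation a x F)) => x y ax xy yb.
have xb := le_trans xy yb.
move: Ffin; rewrite (total_variationD F (le_trans ax xy) yb).
rewrite fin_numD (total_variationD F ax xy) fin_numD => /andP[/andP[f1 f2] _].
rewrite fineD// addrAC subrr add0r -lee_fin fineK//.
exact: total_variation_ge.
Qed.

Fixpoint step_sum F (x : R) (l : seq (R * R)) : R :=
  if l is (v, y) :: l' then v * (F y - F x) + step_sum F y l' else 0.

(** A value [v] is attached to each cell and is only required to be close to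
    [h] on the whole cell. Unlike being the value of [h] at a tag in the cell,
    this survives when the cell is cut, which the comparison below relies on. *)
Fixpoint step_approx h (e b x : R) (l : seq (R * R)) : Prop :=
  if l is (v, y) :: l' then
    [/\ x <= y, forall t, x <= t -> t <= y -> `|v - h t| <= e &
        step_approx h e b y l']
  else x = b.

Lemma step_approx_le h e b x l : step_approx h e b x l -> x <= b.
Proof.
elim: l x => [|[v y] l IH] x /=; first by move=> ->.
by move=> [xy _ /IH]; exact: le_trans.
Qed.

(** The two lists of cells are consumed together from the left, each time up to
    the end of the cell that ends first; the other cell is cut there. On the
    consumed piece the two values differ by at most [2 * e], and the increments
    of [V] telescope. No common refinement is built. *)
Lemma step_sum_close h F V (e a b : R) : 0 <= e ->
  (forall x y, a <= x -> x <= y -> y <= b -> `|F y - F x| <= V y - V x) ->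
  forall l m x, a <= x -> step_approx h e b x l -> step_approx h e b x m ->
  `|step_sum F x l - step_sum F x m| <= 2 * e * (V b - V x).
Proof.
move=> e0 FV l m x.
have [n] := ubnP (size l + size m)%N; elim: n l m x => // n IH l m x.
wlog : l m / match l, m with
             | [::], _ => True
             | (_, y) :: _, (_, z) :: _ => y <= z
             | _ :: _, [::] => False end.
  move=> W; case: l m => [|[v y] l] [|[w z] m]; try exact: W.
    by move=> sz ax Hl Hm; rewrite distrC; apply: W => //; rewrite addnC.
  have [yz|/ltW zy] := leP y z; first exact: W.
  by move=> sz ax Hl Hm; rewrite distrC; apply: W => //; rewrite addnC.
case: l => [|[v y] l]; case: m => [|[w z] m] //=.
- by move=> _ _ _ -> _; rewrite !subrr normr0 mulr0.
- move=> _ sz ax xb [xz _ Hm].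
  (* the exhausted list forces x = b, so the remaining cells are degenerate *)
  have zx : z = x by apply/eqP; rewrite eq_le xz andbT xb (step_approx_le Hm).
  subst z; rewrite subrr mulr0 !add0r.
  have := IH [::] m x; rewrite /= add0r => -> //.
- move=> yz sz ax [xy Hv Hl] [xz Hw Hm].
  have yb := step_approx_le Hl.
  have -> : v * (F y - F x) + step_sum F y l - (w * (F z - F x) + step_sum F z m)
     = (v - w) * (F y - F x) + (step_sum F y l - step_sum F y ((w, z) :: m)).
    by rewrite /=; ring.
  have -> : 2 * e * (V b - V x) = 2 * e * (V y - V x) + 2 * e * (V b - V y).
    by ring.
  apply: le_trans (ler_normD _ _) _; apply: lerD.
    rewrite normrM ler_pM//; last exact: FV.
    have vx := Hv x (lexx _) xy; have wx := Hw x (lexx _) xz.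
    rewrite (le_trans (ler_distD (h x) _ _))// mulr_natl mulr2n lerD//.
    by rewrite distrC.
  apply: IH => //=; first exact: le_trans xy.
  split=> // t yt tz; apply: Hw => //; exact: le_trans yt.
Qed.

Lemma RS_sum_cons h F (a b x : R) s xi :
  RS_sum h F a b (x :: s) xi =
  h (xi 0%N) * (F x - F a) + RS_sum h F x b s (xi \o succn).
Proof. by rewrite /RS_sum /= big_nat_recl. Qed.

Lemma RS_sum_step_sum h F (a b : R) s xi :
  RS_sum h F a b s xi =
  step_sum F a [seq (h (xi i), nth b s i) | i <- iota 0 (size s)].
Proof.
elim: s a xi => [|x s IH] a xi; first by rewrite /RS_sum big_nil.
rewrite RS_sum_cons IH /=; congr (_ + step_sum _ _ _).
by rewrite -[1%N]addn0 iotaDl -map_comp.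
Qed.

Lemma itv_partition_step_approx h (e d a b : R) s xi :
  let x := nth b (a :: s) in
  (forall y z, a <= y <= b -> a <= z <= b -> `|y - z| < d -> `|h y - h z| <= e) ->
  itv_partition a b s ->
  (forall i, (i < size s)%N -> x i <= xi i <= x i.+1 /\ x i.+1 - x i < d) ->
  step_approx h e b a [seq (h (xi i), nth b s i) | i <- iota 0 (size s)].
Proof.
elim: s a xi => [|x s IH] a xi /= hd.
  by move/itv_partition_nil.
move=> abs Hxi.
have abs' := itv_partition_cons abs.
have xb := itv_partition_le abs'.
have [/andP[a0 x0] xad] := Hxi 0%N isT; rewrite /= in a0 x0 xad.
have ax := le_trans a0 x0.
split=> //.
  move=> t at_ tx; apply: hd.
  - by rewrite a0 (le_trans x0).
  - by rewrite at_ (le_trans tx).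
  - by move: a0 x0 at_ tx xad; rewrite ltr_norml; lra.
rewrite -[1%N]addn0 iotaDl -map_comp.
apply: (IH x (xi \o succn)) => //.
  move=> y z /andP[xy yb] /andP[xz zb]; apply: hd.
    by rewrite (le_trans ax).
  by rewrite (le_trans ax).
by move=> i si; apply: (Hxi i.+1).
Qed.

(** Sums over uniform partitions with left tags. They are linear in [h], they
    determine the Stieltjes integral when it exists, and all their tags lie in
    one countable set, so that statements valid almost everywhere for each tag
    hold almost everywhere for all of them. *)
Definition left_sum (n : nat) h F : R :=
  \sum_(0 <= i < n.+1) h (i%:R / n.+1%:R) *
     (F (i.+1%:R / n.+1%:R) - F (i%:R / n.+1%:R)).

Definition uniform_partition (n : nat) : seq R :=
  [seq i.+1%:R / n.+1%:R | i <- iota 0 n.+1].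

Lemma nth_uniform_partition n i : (i <= n.+1)%N ->
  nth 1 (0 :: uniform_partition n) i = i%:R / n.+1%:R :> R.
Proof.
case: i => [|i] /=; first by rewrite mul0r.
move=> iLn; rewrite (nth_map 0%N) ?size_iota// nth_iota//.
Qed.

Lemma size_uniform_partition n : size (uniform_partition n) = n.+1.
Proof. by rewrite size_map size_iota. Qed.

Lemma itv_partition_uniform n : itv_partition 0 1 (uniform_partition n).
Proof.
split.
  apply/(pathP 1) => i; rewrite size_uniform_partition => iLn.
  have /= -> := nth_uniform_partition (ltnW iLn).
  have /= -> := @nth_uniform_partition n i.+1 iLn.
  by rewrite ltr_pM2r ?invr_gt0// ltr_nat.
rewrite (last_nth 1) size_uniform_partition nth_uniform_partition//.
by rewrite divff.
Qed.

Lemma RS_sum_uniform n h F :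
  RS_sum h F 0 1 (uniform_partition n) (fun i => i%:R / n.+1%:R) =
  left_sum n h F.
Proof.
rewrite /RS_sum size_uniform_partition /left_sum !big_mkord.
apply: eq_bigr => i _; rewrite -!nth_uniform_partition//; last exact: ltnW.
Qed.

Lemma uniform_partition_fine (d : R) : 0 < d ->
  \forall n \near \oo, forall i, (i < size (uniform_partition n))%N ->
   let x := nth 1 (0 :: uniform_partition n) in
         x i <= i%:R / n.+1%:R <= x i.+1 /\ x i.+1 - x i < d.
Proof.
move=> d0.
near=> n => i; rewrite size_uniform_partition => iLn.
rewrite (nth_uniform_partition (ltnW iLn)) (nth_uniform_partition iLn).
rewrite lexx ler_pM2r ?invr_gt0// ler_nat leqnSn; split => //.
rewrite -mulrBl -natrB// subSnn mul1r.
by near: n; exact: near_infty_natSinv_lt (PosNum d0).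
Unshelve. all: by end_near. Qed.

Lemma is_RS_left_sum h F l : is_RS h F 0 1 l ->
  left_sum n h F @[n --> \oo] --> l.
Proof.
move=> H; apply/cvgrPdist_lt => e e0.
have [d d0 dP] := H e e0.
have := uniform_partition_fine d0; apply: filterS => n Hn.
rewrite distrC -RS_sum_uniform; apply: dP => //.
exact: itv_partition_uniform.
Qed.

Lemma RS01P h F : RS_integrable01 h F -> is_RS h F 0 1 (RS01 h F).
Proof. by move=> [l Hl]; apply: (xgetPex 0 (ex_intro _ l Hl)). Qed.

Lemma RS01_cvg h F : RS_integrable01 h F ->
  left_sum n h F @[n --> \oo] --> RS01 h F.
Proof. by move=> /RS01P; exact: is_RS_left_sum. Qed.

(** Uniform continuity makes the tagged sums of any two fine partitions close
    ([step_sum_close]). Hence the sums over uniform partitions form a Cauchy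
    sequence, and all fine sums are close to its limit. *)
Lemma RS_integrable_continuous h F : C01 h -> bounded_variation 0 1 F ->
  RS_integrable01 h F.
Proof.
move=> hc /(bounded_variation_increment ler01)[V FV].
have V0 : 0 <= V 1 - V 0 by apply: le_trans (FV 0 1 _ _ _).
have key : forall e : R, 0 < e -> exists2 d : R, 0 < d &
    forall s xi s' xi', itv_partition 0 1 s -> itv_partition 0 1 s' ->
    (forall i, (i < size s)%N -> let x := nth 1 (0 :: s) in
       x i <= xi i <= x i.+1 /\ x i.+1 - x i < d) ->
    (forall i, (i < size s')%N -> let x := nth 1 (0 :: s') in
       x i <= xi' i <= x i.+1 /\ x i.+1 - x i < d) ->
    `|RS_sum h F 0 1 s xi - RS_sum h F 0 1 s' xi'| < e.
  move=> e e0.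
  (* 1 is added because the total variation may vanish *)
  pose e' := e / (2 * (V 1 - V 0 + 1)).
  have e'0 : 0 < e' by rewrite divr_gt0// mulr_gt0// ltr_wpDl.
  have [d d0 dP] := segment_uniform_continuous hc e'0.
  exists d => // s xi s' xi' ps ps' Hs Hs'.
  have hd : forall y z, 0 <= y <= 1 -> 0 <= z <= 1 -> `|y - z| < d ->
      `|h y - h z| <= e'.
    move=> y z y01 z01 yz.
    by apply/ltW/dP => //=; rewrite in_itv.
  rewrite !RS_sum_step_sum.
  have := step_sum_close (ltW e'0) FV (lexx 0)
    (itv_partition_step_approx hd ps Hs) (itv_partition_step_approx hd ps' Hs').
  move/le_lt_trans; apply.
  have W1 : 0 < V 1 - V 0 + 1 by rewrite ltr_wpDl.
  have -> : 2 * e' * (V 1 - V 0) = e * ((V 1 - V 0) / (V 1 - V 0 + 1)).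
    by rewrite /e'; field; rewrite gt_eqF.
  by rewrite gtr_pMr// ltr_pdivrMr// mul1r ltrDl.
have : cvgn (fun n => left_sum n h F).
  apply/cauchy_cvgP/cauchy_exP => e e0.
  have [d d0 dP] := key e e0.
  have Hd := uniform_partition_fine d0.
  near \oo => n.
  exists (left_sum n h F).
  suff: \forall m \near \oo, `|left_sum n h F - left_sum m h F| < e by [].
  near=> m; rewrite -!RS_sum_uniform.
  apply: dP; try exact: itv_partition_uniform.
    by near: n.
  by near: m.
move=> /cvg_ex[/= l Hl]; exists l => e e0.
have e20 : 0 < e / 2 by rewrite divr_gt0.
have [d d0 dP] := key _ e20.
exists d => // s xi x ps Hs.
near \oo => n.
rewrite (splitr e) (le_lt_trans (ler_distD (left_sum n h F) _ _))// ltrD//.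
  rewrite -RS_sum_uniform; apply: dP => //; first exact: itv_partition_uniform.
  by near: n; exact: uniform_partition_fine.
rewrite distrC.
by near: n; apply: cvgr_dist_lt.
Unshelve. all: by end_near. Qed.

Lemma left_sum_bound F : bounded_variation 0 1 F -> exists2 W : R, 0 <= W &
  forall n h M, (forall i, (i <= n)%N -> `|h (i%:R / n.+1%:R)| <= M) ->
    `|left_sum n h F| <= W * M.
Proof.
move=> /(bounded_variation_increment ler01)[V FV].
exists (V 1 - V 0); first by apply: le_trans (FV 0 1 _ _ _).
move=> n h M hM.
rewrite (le_trans (ler_norm_sum _ _ _))//.
have tel : V 1 - V 0 =
    \sum_(0 <= i < n.+1) (V (i.+1%:R / n.+1%:R) - V (i%:R / n.+1%:R)).
  by rewrite telescope_sumr// divff// mul0r.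
rewrite tel mulr_suml !big_mkord; apply: ler_sum => -[i /= iLn] _.
rewrite normrM mulrC ler_pM//; last exact: hM.
apply: FV.
- by rewrite divr_ge0.
- by rewrite ler_pM2r ?invr_gt0// ler_nat.
- by rewrite ler_pdivrMr// mul1r ler_nat.
Qed.

Lemma left_tag01 n i : (i <= n)%N -> I01 (i%:R / n.+1%:R : R).
Proof.
move=> iLn; rewrite /= in_itv/= divr_ge0//=.
by rewrite ler_pdivrMr// mul1r ler_nat ltnW.
Qed.

End RS.

(** * Integrals and measurability up to null sets *)

Section ae_integral.
Context d (T : measurableType d) (R : realType).
Variables (mu : {measure set T -> \bar R}) (D : set T).
Hypothesis mD : measurable D.
Implicit Types f g h : T -> R.

Lemma ae_eq_Rintegral f g : measurable_fun D f -> measurable_fun D g ->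
  {ae mu, forall x, D x -> f x = g x} ->
  \int[mu]_(x in D) f x = \int[mu]_(x in D) g x.
Proof.
move=> mf mg fg; congr fine; apply: ae_eq_integral => //.
- exact/measurable_EFinP.
- exact/measurable_EFinP.
- by apply: filterS fg => x + Dx => ->.
Qed.

Lemma ae_eq0_Rintegral f : measurable_fun D f ->
  {ae mu, forall x, D x -> f x = 0} -> \int[mu]_(x in D) f x = 0.
Proof.
move=> mf f0; transitivity (\int[mu]_(x in D) (cst 0 x : R)).
  exact: ae_eq_Rintegral.
by rewrite Rintegral_cst// mul0r.
Qed.

Lemma ae_eq_integrable f g : measurable_fun D g ->
  {ae mu, forall x, D x -> f x = g x} ->
  mu.-integrable D (EFin \o f) -> mu.-integrable D (EFin \o g).
Proof.
move=> mg fg fi; have /measurable_EFinP mf := measurable_int _ fi.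
case/integrableP : fi => _ foo; apply/integrableP; split.
  exact/measurable_EFinP.
rewrite (_ : integral _ _ _ = \int[mu]_(x in D) `|(f x)%:E|)%E//.
apply: ae_eq_integral => //.
- by apply: measurableT_comp => //; exact/measurable_EFinP.
- by apply: measurableT_comp => //; exact/measurable_EFinP.
- by apply: filterS fg => x + Dx => /= ->.
Qed.

(** Replacing [g] by the maximum of [f] and [g], which is almost everywhere
    equal to it, reduces this to a pointwise inequality. *)
Lemma ae_le_Rintegral f g :
  mu.-integrable D (EFin \o f) -> mu.-integrable D (EFin \o g) ->
  {ae mu, forall x, D x -> f x <= g x} ->
  \int[mu]_(x in D) f x <= \int[mu]_(x in D) g x.
Proof.
move=> fi gi fg.
have /measurable_EFinP mf := measurable_int _ fi.
have /measurable_EFinP mg := measurable_int _ gi.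
have mm : measurable_fun D (fun x => Num.max (f x) (g x)).
  exact: measurable_maxr.
have gm : {ae mu, forall x, D x -> g x = Num.max (f x) (g x)}.
  by apply: filterS fg => x fgx Dx; rewrite (max_idPr (fgx Dx)).
rewrite (ae_eq_Rintegral mg mm gm); apply: le_Rintegral => //.
  exact: ae_eq_integrable gm gi.
by move=> x Dx; rewrite le_max lexx.
Qed.

Lemma ae_dominated_integrable f g : measurable_fun D f ->
  {ae mu, forall x, D x -> `|f x| <= g x} ->
  mu.-integrable D (EFin \o g) -> mu.-integrable D (EFin \o f).
Proof.
move=> mf fg gi.
have /measurable_EFinP mg := measurable_int _ gi.
have mm : measurable_fun D (fun x => Num.max `|f x| (g x)).
  by apply: measurable_maxr => //; exact: measurableT_comp.
have gm : {ae mu, forall x, D x -> g x = Num.max `|f x| (g x)}.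
  by apply: filterS fg => x fgx Dx; rewrite (max_idPr (fgx Dx)).
apply: (le_integrable mD _ _ (ae_eq_integrable mm gm gi)).
  exact/measurable_EFinP.
move=> x Dx /=; rewrite lee_fin (le_trans _ (ler_norm _))//.
by rewrite le_max lexx.
Qed.

Lemma ae_Rintegral_ge0 f :
  mu.-integrable D (EFin \o f) -> {ae mu, forall x, D x -> 0 <= f x} ->
  0 <= \int[mu]_(x in D) f x.
Proof.
move=> fi f0.
have i0 : mu.-integrable D (EFin \o (cst 0 : T -> R)) by exact: integrable0.
rewrite -(ae_eq0_Rintegral (measurable_cst (0 : R)) (aeW _ (fun _ _ => erefl))).
exact: ae_le_Rintegral.
Qed.

Lemma ae_Rintegral_eq0 f :
  mu.-integrable D (EFin \o f) -> {ae mu, forall x, D x -> 0 <= f x} ->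
  \int[mu]_(x in D) f x = 0 -> {ae mu, forall x, D x -> f x = 0}.
Proof.
move=> fi f0 If.
have /measurable_EFinP mf := measurable_int _ fi.
have mEf : measurable_fun D (EFin \o f) by exact/measurable_EFinP.
have : (\int[mu]_(x in D) `|(EFin \o f) x| = 0)%E.
  rewrite -(fineK (integrable_fin_num _ (integrable_abse fi)))//.
  congr EFin; rewrite -[RHS]If; apply: ae_eq_Rintegral => //.
    exact: measurableT_comp.
  by apply: filterS f0 => x fx Dx; rewrite ger0_norm// fx.
move/(ae_eq_integral_abs mu mD mEf).
by apply: filterS => x + Dx => /(_ Dx) [].
Qed.

Lemma ae_Rintegral_gt0 f :
  mu.-integrable D (EFin \o f) -> {ae mu, forall x, D x -> 0 <= f x} ->
  ~ {ae mu, forall x, D x -> f x = 0} -> 0 < \int[mu]_(x in D) f x.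
Proof.
move=> fi f0 fn0; rewrite lt_neqAle (ae_Rintegral_ge0 fi f0) andbT eq_sym.
by apply/eqP => /(ae_Rintegral_eq0 fi f0).
Qed.

Lemma ae_Rintegral_subset (E : set T) f : measurable E -> E `<=` D ->
  mu.-integrable D (EFin \o f) -> {ae mu, forall x, D x -> 0 <= f x} ->
  \int[mu]_(x in E) f x <= \int[mu]_(x in D) f x.
Proof.
move=> mE ED fi f0.
have -> : \int[mu]_(x in E) f x = \int[mu]_(x in D) ((f \_ E) x).
  by rewrite -Rintegral_mkcondr (setIidr ED).
apply: ae_le_Rintegral => //.
  rewrite (_ : EFin \o f \_ E = (EFin \o f) \_ E); last first.
    by apply/funext => x /=; rewrite !patchE; case: ifP.
  apply/integrable_restrict => //.
  by rewrite (setIidr ED); exact: integrableS fi.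
apply: filterS f0 => x f0 Dx; rewrite patchE; case: ifP => // _.
exact: f0.
Qed.

Lemma Rintegral_dominated_cvg (h : nat -> T -> R) f g :
  (forall n, measurable_fun D (h n)) -> measurable_fun D f ->
  {ae mu, forall x, D x -> h n x @[n --> \oo] --> f x} ->
  mu.-integrable D (EFin \o g) ->
  {ae mu, forall x, D x -> forall n, `|h n x| <= g x} ->
  \int[mu]_(x in D) h n x @[n --> \oo] --> \int[mu]_(x in D) f x.
Proof.
move=> mh mf hf gi hg.
have [||||| fi _ cv] := @dominated_convergence _ T R mu D mD
  (fun n => EFin \o h n) (EFin \o f) (EFin \o g).
- by move=> n; exact/measurable_EFinP.
- exact/measurable_EFinP.
- apply: filterS hf => x + Dx => /(_ Dx) hfx.
  exact: (cvg_comp _ _ hfx).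
- exact: gi.
- by apply: filterS hg => x + n Dx => /(_ Dx n); rewrite lee_fin.
apply: fine_cvg; rewrite fineK//; exact: integrable_fin_num.
Qed.

Lemma Rintegral_sum n (F : nat -> T -> R) :
  (forall i, (i < n)%N -> mu.-integrable D (EFin \o F i)) ->
  \int[mu]_(x in D) (\sum_(0 <= i < n) F i x) =
  \sum_(0 <= i < n) \int[mu]_(x in D) F i x.
Proof.
move=> Fi.
have {}Fi i : (i < n)%N -> mu.-integrable D (fun x => (F i x)%:E) := Fi i.
elim: n Fi => [|n IH] Fi.
  rewrite big_nil; under eq_Rintegral do rewrite big_nil.
  by rewrite Rintegral_cst// mul0r.
rewrite big_nat_recr//= -IH => [|i ni]; last by apply: Fi; exact: leqW.
under eq_Rintegral do rewrite big_nat_recr//=.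
rewrite RintegralD//; last exact: Fi.
rewrite (_ : EFin \o _ = fun x => (\sum_(i < n) (F i x)%:E)%E).
  by apply: integrable_sum => // -[i /= ni] _; apply: Fi; exact: leqW.
by apply/funext => x /=; rewrite big_mkord sumEFin.
Qed.

Hypothesis cmu : measure_is_complete mu.

Lemma ae_eq_measurable f g : {ae mu, forall x, D x -> f x = g x} ->
  measurable_fun D f -> measurable_fun D g.
Proof.
move=> fg /measurable_EFinP mf; apply/measurable_EFinP.
apply: (ae_measurable_fun cmu) mf.
by apply: filterS fg => x + Dx => /= ->.
Qed.

(** The sequence and its limit are multiplied by the indicator of the set where
    convergence holds, which changes them on a null set only and makes the
    convergence hold everywhere. *)
Lemma ae_cvg_measurable (h : nat -> T -> R) f :
  (forall n, measurable_fun D (h n)) ->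
  {ae mu, forall x, D x -> h n x @[n --> \oo] --> f x} ->
  measurable_fun D f.
Proof.
move=> mh [N [mN N0 Nsub]].
pose p x : R := \1_(~` N) x.
have mp : measurable_fun D p.
  by apply: measurable_funTS; apply: measurable_indic; exact: measurableC.
apply: (@ae_eq_measurable (fun x => f x * p x)).
  exists N; split => // x /= /not_implyP[Dx fx]; apply: contrapT => Nx.
  by apply: fx; rewrite /p indicE mem_set// mulr1.
apply: (measurable_fun_cvg (h := fun n x => h n x * p x)).
  by move=> n; exact: measurable_funM.
move=> x Dx; have [Nx|Nx] := pselect (N x).
  have -> : p x = 0 by rewrite /p indicE memNset// => /(_ Nx).
  under eq_fun do rewrite mulr0.
  by rewrite mulr0; exact: cvg_cst.
apply: cvgM; last exact: cvg_cst.
by apply: contrapT => hx; apply: Nx; apply: Nsub => /= /(_ Dx).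
Qed.

End ae_integral.

Lemma ae_weighted_Rintegral_lt d (T : measurableType d) (R : realType)
    (mu : {measure set T -> \bar R}) (D : set T) (mD : measurable D)
    (q v w : T -> R) :
  mu.-integrable D (EFin \o (fun x => q x * v x)) ->
  mu.-integrable D (EFin \o (fun x => q x * w x)) ->
  {ae mu, forall x, D x -> 0 <= q x} -> {ae mu, forall x, D x -> v x < w x} ->
  ~ {ae mu, forall x, D x -> q x = 0} ->
  \int[mu]_(x in D) (q x * v x) < \int[mu]_(x in D) (q x * w x).
Proof.
move=> qvi qwi q0 vw qn0; rewrite -subr_gt0 -RintegralB//.
apply: ae_Rintegral_gt0 => //.
- exact: (integrableB mD qwi qvi).
- apply: filterS2 q0 vw => x q0 vw Dx.
  by rewrite -mulrBr mulr_ge0 ?q0// subr_ge0 ltW ?vw.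
- move=> h0; apply: qn0; apply: filterS2 vw h0 => x vw h0 Dx.
  move/eqP: (h0 Dx); rewrite -mulrBr mulf_eq0 => /orP[/eqP//|].
  by rewrite subr_eq0 => /eqP wv; move: (vw Dx); rewrite wv ltxx.
Qed.

(** * Lebesgue measure on the unit interval and sections of kernels *)

Section Lebesgue01.
Context {R : realType}.
Local Notation mu := (@completed_lebesgue_measure R).

Global Instance lebesgue_ae_filter : Filter (almost_everywhere mu).
Proof. exact: (ae_filter_ringOfSetsType mu). Qed.

Lemma ae01S (P Q : R -> Prop) : (forall s, I01 s -> P s -> Q s) ->
  ae01 P -> ae01 Q.
Proof. by move=> PQ; rewrite /ae01; apply: filterS => s + Is => /(_ Is); exact: PQ. Qed.

Lemma ae01S2 (P1 P2 Q : R -> Prop) :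
  (forall s, I01 s -> P1 s -> P2 s -> Q s) -> ae01 P1 -> ae01 P2 -> ae01 Q.
Proof.
move=> PQ; rewrite /ae01; apply: filterS2 => s + + Is => /(_ Is) P1s /(_ Is).
exact: PQ.
Qed.

Lemma ae01S3 (P1 P2 P3 Q : R -> Prop) :
  (forall s, I01 s -> P1 s -> P2 s -> P3 s -> Q s) ->
  ae01 P1 -> ae01 P2 -> ae01 P3 -> ae01 Q.
Proof.
move=> PQ; rewrite /ae01; apply: filterS3 => s + + + Is.
move=> /(_ Is) P1s /(_ Is) P2s /(_ Is); exact: PQ.
Qed.

Lemma ae01_foralln (P : nat -> R -> Prop) :
  (forall n, ae01 (P n)) -> ae01 (fun s => forall n, P n s).
Proof.
by move=> /ae_foralln; apply: filterS => s Ps Is n; exact: Ps.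
Qed.

Lemma borel_lebesgue_measurable (E : set R) :
  measurable (E : set (measurableTypeR R)) -> measurable (E : set (LebR R)).
Proof. exact: sub_caratheodory. Qed.

Lemma measurable_segment (a b : R) : measurable (`[a, b]%classic : set (LebR R)).
Proof. apply: borel_lebesgue_measurable; exact: measurable_itv. Qed.

(** An interval contained in a null set would have length 0. *)
Lemma ae_dense01 (P : R -> Prop) (tau e : R) : ae01 P -> I01 tau -> 0 < e ->
  exists t, [/\ I01 t, `|tau - t| < e & P t].
Proof.
move=> [N [mN N0 NP]] /=; rewrite in_itv/= => /andP[tau0 tau1] e0.
apply: contrapT => H.
pose x := Num.max 0 (tau - e / 2); pose y := Num.min 1 (tau + e / 2).
have e20 : 0 < e / 2 by rewrite divr_gt0.
have xy : x < y.
  by rewrite /x /y gt_max !lt_min ltr01 /=; apply/and3P; split; lra.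
have sub : `]x, y[%classic `<=` N.
  move=> t /=; rewrite in_itv/= /x /y gt_max lt_min => /andP[/andP[t0 t1] /andP[t2 t3]].
  apply: NP => /=; apply/not_implyP.
  have It : I01 t by rewrite /= in_itv/= !ltW.
  split => // Pt; apply: H; exists t; split => //.
  by rewrite ltr_norml; lra.
have := @lebesgue_measure_itv R `]x, y[.
rewrite lte_fin xy => Hxy.
have : (mu `]x, y[%classic <= mu N)%E.
  apply: le_measure => //; rewrite inE//.
  apply: borel_lebesgue_measurable; exact: measurable_itv.
rewrite N0; apply/negP; rewrite -ltNge.
rewrite (_ : mu _ = (y - x)%:E) ?lte_fin ?subr_gt0//.
Qed.

Local Notation mu2 := (mu \x mu)%E.

(** By Tonelli a null set of the plane has null sections at almost every [t],
    so adding a negligible set to a product-measurable one keeps almost every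
    section measurable for the complete measure on the line. *)
Lemma ae_xsection_measurable
    (E : set (g_sigma_algebraType (completed_algebra_gen mu2))) :
  measurable E ->
  {ae mu, forall t : R, measurable ([set s | E (t, s)] : set (LebR R))}.
Proof.
move: E.
apply: smallest_sub; first split => /=.
- by apply: aeW => t; exact: measurable0.
- move=> A; apply: filterS => t mA.
  rewrite (_ : [set _ | _] = ~` [set s | A (t, s)]); first exact: measurableC.
  by apply/seteqP; split => s /=; [case|].
- move=> F /ae_foralln; apply: filterS => t mF.
  rewrite (_ : [set _ | _] = \bigcup_n [set s | F n (t, s)]); last first.
    by apply/seteqP; split => s [n _ Fs]; exists n.
  exact: bigcupT_measurable.
move=> _ [A mA [N [N' [mN' N'0 NN']]] <-].
have N'0t : {ae mu, forall t : R, mu (xsection N' t) = 0%E}.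
  have mN't : measurable_fun setT (fun t : LebR R => mu (xsection N' t)).
    exact: measurable_fun_xsection.
  have : (\int[mu]_t `|mu (xsection N' t)| = 0)%E.
    by rewrite -[RHS]N'0; apply: eq_integral => t _; rewrite gee0_abs.
  move=> /(ae_eq_integral_abs mu measurableT mN't).
  by apply: filterS => t; exact.
apply: filterS N'0t => t N't0.
rewrite (_ : [set _ | _] = xsection A t `|` [set s | N (t, s)]); last first.
  by apply/seteqP; split => s; rewrite xsectionE.
apply: measurableU; first exact: measurable_xsection.
apply: completed_lebesgue_measure_is_complete.
exists (xsection N' t); split => //; first exact: measurable_xsection.
by move=> s /= Ns; rewrite xsectionE; exact: NN'.
Qed.

Lemma measurable_square :
  measurable (I01 `*` I01 : set (g_sigma_algebraType (completed_algebra_gen mu2))).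
Proof.
apply: sub_sigma_algebra; exists (I01 `*` I01).
  by apply: measurableX; exact: measurable_segment.
by exists set0; [exact: negligible_set0|rewrite setU0].
Qed.

Lemma ae_Lmeasurable_section (k : R -> R -> R) : Lmeasurable01x01 k ->
  ae01 (fun t => Lmeasurable01 (k t)).
Proof.
move=> /(_ measurable_square) mk.
(* rational thresholds, so that one null set of parameters serves for all *)
pose q n : R := ratr (odflt 0 (unpickle n) : rat).
have : {ae mu, forall t : R, forall n, measurable
    ([set s | (I01 t /\ I01 s) /\ q n < k t s] : set (LebR R))}.
  apply: ae_foralln => n.
  have /ae_xsection_measurable := mk _ (measurable_itv `]q n, +oo[).
  apply: filterS => t.
  rewrite (_ : [set s | _ (t, s)] = [set s | (I01 t /\ I01 s) /\ q n < k t s])//.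
  by apply/seteqP; split => s /=; rewrite !in_itv/= andbT.
apply: filterS => t mt It.
apply: (measurability _ (RGenOInfty.measurableE R)) => // _ [_ [x ->] <-].
rewrite (_ : _ `&` _ = \bigcup_n (if x < q n then
   [set s | (I01 t /\ I01 s) /\ q n < k t s] else set0)).
  by apply: bigcupT_measurable => n; case: ifP.
apply/seteqP; split => [s [Is xk0]|s [n _]].
  have xk : x < k t s by move: xk0 => /=; rewrite ?in_itv/= ?andbT.
  have [r] := rat_in_itvoo xk; rewrite in_itv/= => /andP[xr rk].
  by exists (pickle r) => //; rewrite /q pickleK /= xr /=; split.
case: ifP => // xq [[_ Is] qk]; split => //=.
by rewrite ?in_itv/= ?andbT (lt_trans xq).
Qed.

(** Almost every section is measurable, so the parameters of measurable
    sections are dense, and continuity in the parameter makes every section an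
    almost everywhere limit of measurable ones. *)
Lemma Lmeasurable_section (k : R -> R -> R) : Lmeasurable01x01 k ->
  (forall tau, I01 tau -> ae01 (fun s =>
     `|k t s - k tau s| @[t --> within I01 (nbhs tau)] --> (0 : R))) ->
  forall tau, I01 tau -> Lmeasurable01 (k tau).
Proof.
move=> /ae_Lmeasurable_section mk klim tau Itau.
have tn n : exists t, [/\ I01 t, `|tau - t| < n.+1%:R^-1 & Lmeasurable01 (k t)].
  exact: ae_dense01.
have [t tP] := choice tn.
apply: (@ae_cvg_measurable _ (LebR R) R mu I01 completed_lebesgue_measure_is_complete
   (fun n => k (t n))).
  by move=> n; have [] := tP n.
apply: ae01S (klim _ Itau) => s Is cvs.
have tw : t n @[n --> \oo] --> within I01 (nbhs tau).
  move=> A [e /= e0 eA].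
  suff: \forall n \near \oo, A (t n) by [].
  near=> n; have [It tt _] := tP n.
  apply: eA => //=; apply: lt_trans tt _.
  by near: n; exact: near_infty_natSinv_lt (PosNum e0).
have := cvg_comp _ _ tw cvs.
by move=> /norm_cvg0P /cvg_sub0; apply; exact: cvg_cst.
Unshelve. all: by end_near. Qed.

End Lebesgue01.

(** * Superposition with a Caratheodory function *)

Section Caratheodory.
Context {R : realType}.
Local Notation mu := (@completed_lebesgue_measure R).

Lemma Linfty01_measurable (h : R -> R) : Linfty01 h -> Lmeasurable01 h.
Proof.
move=> /sub_Lfun_mfun; rewrite inE /= => mh.
by apply/(measurable_restrictT _ (measurable_segment 0 1)).
Qed.

Lemma Linfty01_bounded (h : R -> R) : Linfty01 h ->
  exists M : R, ae01 (fun s => `|h s| <= M).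
Proof.
move=> /sub_Lfun_finLfun; rewrite inE /= /finite_norm unlock.
case: ifPn => [_ hoo|]; last first.
  rewrite lt0e measure_ge0 andbT negbK => /eqP mu0 _.
  by exists 0; apply: measure0_ae.
have [M hM] : exists M, \forall x \ae mu, `|(h \_ I01) x| <= M.
  exact: (@ess_supr_bounded _ (LebR R) R mu (fun x => `|(h \_ I01) x|)).
by exists M; apply: filterS hM => s + Is; rewrite patchE mem_set.
Qed.

Lemma C01_max_norm (u : R -> R) : C01 u ->
  exists2 c, I01 c & forall s, I01 s -> `|u s| <= `|u c|.
Proof.
move=> /subspace_continuousP uc.
have nuc : {within `[0, 1], continuous (fun s => `|u s|)}.
  apply/subspace_continuousP => s Is; apply: cvg_norm; exact: uc.
have [c Ic cP] := EVT_max ler01 nuc.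
by exists c.
Qed.

Lemma C01_bounded (u : R -> R) : C01 u ->
  exists2 r : R, 0 < r & forall s, I01 s -> `|u s| < r.
Proof.
move=> /C01_max_norm[c _ cP].
exists (`|u c| + 1); first by rewrite ltr_wpDl.
by move=> s Is; rewrite (le_lt_trans (cP s Is))// ltrDl.
Qed.

(** Replacing [u s] by the value of [u] at the left end of the cell of length
    1 / (n + 1) containing [s] gives, on each cell, a section of [f] at a fixed
    value, hence a measurable function; continuity of [u] and of [f s] gives
    convergence. *)
Lemma Lmeasurable_superposition (f : R -> R -> R) (u : R -> R) :
  (forall v, Lmeasurable01 (f ^~ v)) -> ae01 (fun t => continuous (f t)) ->
  C01 u -> Lmeasurable01 (fun s => f s (u s)).
Proof.
move=> mf fc uc.
pose tag n (s : R) : R := (Num.truncn (n.+1%:R * s))%:R / n.+1%:R.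
have tagP n s : I01 s -> tag n s <= s < tag n s + n.+1%:R^-1.
  rewrite /= in_itv/= => /andP[s0 _].
  have := @truncn_itv R (n.+1%:R * s) _.
  rewrite mulr_ge0// => /(_ isT) /andP[t1 t2].
  rewrite /tag -[X in _ + X]mul1r -mulrDl natr1.
  by rewrite ler_pdivrMr// ltr_pdivlMr// [s * _]mulrC t1 t2.
have tag01 n s : I01 s -> I01 (tag n s).
  move=> Is; have /andP[t1 _] := tagP n s Is; move: Is.
  rewrite /= !in_itv/= => /andP[s0 s1]; rewrite (le_trans t1)// andbT.
  by rewrite divr_ge0.
apply: (@ae_cvg_measurable _ (LebR R) R mu I01 completed_lebesgue_measure_is_complete
   (fun n s => f s (u (tag n s)))).
  move=> n.
  pose E i : set R := I01 `&` `[i%:R / n.+1%:R, i.+1%:R / n.+1%:R[%classic.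
  have mE i : measurable (E i : set (LebR R)).
    apply: measurableI; first exact: measurable_segment.
    by apply: borel_lebesgue_measurable; exact: measurable_itv.
  rewrite (_ : I01 = \bigcup_i E i); last first.
    apply/seteqP; split => [s Is|s [i _ []//]].
    exists (Num.truncn (n.+1%:R * s)) => //; split => //=.
    have := tagP n s Is; rewrite /tag in_itv/=.
    by rewrite -[X in _ + X]mul1r -mulrDl natr1.
  apply/(measurable_fun_bigcup _ mE) => i.
  apply: (@eq_measurable_fun _ _ (LebR R) R (E i) (f ^~ (u (i%:R / n.+1%:R)))).
    move=> s; rewrite inE => -[Is]; rewrite /= in_itv/=.
    rewrite ler_pdivrMr// ltr_pdivlMr// [s * _]mulrC => /truncn_def si.
    by rewrite /tag si.
  apply: measurable_funS (mf _) => //; first exact: measurable_segment.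
  by move=> s [].
apply: ae01S fc => s Is fs.
apply: (cvg_comp (fun n => u (tag n s)) (f s)); last exact: fs.
apply/cvgrPdist_lt => e e0.
have [d d0 dP] := within_continuous_dist uc Is e0.
near=> n; apply: dP; first exact: tag01.
have /andP[t1 t2] := tagP n s Is.
rewrite ger0_norm ?subr_ge0//.
rewrite ltrBlDl (lt_trans t2)// ltrD2l.
by near: n; exact: near_infty_natSinv_lt (PosNum d0).
Unshelve. all: by end_near. Qed.

(** For each fixed value the bound holds off a null set that depends on the
    value. Only rational values are used, and continuity of [f s] carries the
    bound over to the value [u s]. *)
Lemma superposition_bounded (f : R -> R -> R) (u : R -> R) :
  (forall t v, I01 t -> 0 <= f t v) -> caratheodory f -> C01 u ->
  exists M : R, ae01 (fun s => `|f s (u s)| <= M).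
Proof.
move=> f0 [_ fc fb] uc.
(* u stays strictly inside ]-r, r[, which leaves room for rationals near u s *)
have [r r0 ur] := C01_bounded uc.
have [phi /Linfty01_bounded[M phiM] fphi] := fb r r0.
exists M.
have fq : ae01 (fun s => forall n : nat,
    let q := ratr (odflt 0 (unpickle n) : rat) in - r <= q <= r -> f s q <= phi s).
  apply: ae01_foralln => n; pose q : R := ratr (odflt 0 (unpickle n) : rat).
  have [rq|rq] := boolP (- r <= q <= r).
    by apply: ae01S (fphi q rq).
  by apply: aeW => s _ q' rq'; case: (negP rq rq').
apply: ae01S3 fc phiM fq => s Is fs hM fq.
rewrite ger0_norm; last exact: f0.
apply: le_trans (le_trans (ler_norm _) hM).
rewrite leNgt; apply/negP => phif.
have /cvgrPdist_lt /(_ (f s (u s) - phi s)) := fs (u s).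
rewrite subr_gt0 => /(_ phif) -[d /= d0 dP].
have := ur s Is; rewrite ltr_norml => /andP[ur1 ur2].
have : Num.max (- r) (u s - d) < Num.min r (u s + d).
  by rewrite gt_max !lt_min; apply/and3P; split; lra.
move=> /rat_in_itvoo[q]; rewrite in_itv/= gt_max lt_min.
move=> /andP[/andP[q1 q2] /andP[q3 q4]].
have := fq (pickle q); rewrite pickleK /= (ltW q1) (ltW q3) => /(_ isT) fqphi.
have : `|f s (u s) - f s (ratr q)| < f s (u s) - phi s.
  by apply: dP; rewrite /ball_/= ltr_norml; lra.
by rewrite ltr_norml; lra.
Qed.

End Caratheodory.

(** * Kernels dominated by [Phi] *)

Section Dominated.
Context {R : realType}.
Local Notation mu := (@completed_lebesgue_measure R).
Variables (Phi g : R -> R).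
Implicit Types (h w F : R -> R) (k : R -> R -> R).

(** The class of kernel sections for which all integrals below make sense: it
    is a vector space and contains [k t], the functions [calK k A] and
    [calK k B], and hence the sections of [kS]. *)
Definition dominated01 h : Prop :=
  Lmeasurable01 h /\ exists C, ae01 (fun s => `|h s| <= C * Phi s).

Lemma dominated01_0 : dominated01 (fun=> 0).
Proof.
split; first exact: measurable_cst.
by exists 0; apply: aeW => s _; rewrite normr0 mul0r.
Qed.

Lemma dominated01D h1 h2 : dominated01 h1 -> dominated01 h2 ->
  dominated01 (fun s => h1 s + h2 s).
Proof.
move=> [m1 [C1 H1]] [m2 [C2 H2]]; split; first exact: measurable_funD.
exists (C1 + C2); apply: ae01S2 H1 H2 => s _ H1 H2.
by rewrite mulrDl (le_trans (ler_normD _ _))// lerD.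
Qed.

Lemma dominated01Zl (c : R) h : dominated01 h -> dominated01 (fun s => c * h s).
Proof.
move=> [m1 [C1 H1]]; split; first by apply: measurable_funM.
exists (`|c| * C1); apply: ae01S H1 => s _ H1.
by rewrite normrM -mulrA ler_wpM2l.
Qed.

Lemma dominated01_max0 h : dominated01 h -> dominated01 (fun s => Num.max (h s) 0).
Proof.
move=> [m1 [C1 H1]]; split; first by apply: measurable_maxr.
exists C1; apply: ae01S H1 => s _; apply: le_trans.
by rewrite ger0_norm ?le_max ?lexx ?orbT// ge_max ler_norm normr_ge0.
Qed.

Lemma dominated01_sum n (h : nat -> R -> R) :
  (forall i, (i < n)%N -> dominated01 (h i)) ->
  dominated01 (fun s => \sum_(0 <= i < n) h i s).
Proof.
elim: n => [|n IH] hd.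
  rewrite (_ : (fun _ => _) = fun=> 0); first exact: dominated01_0.
  by apply/funext => s; rewrite big_nil.
rewrite (_ : (fun _ => _) = fun s => \sum_(0 <= i < n) h i s + h n s).
  apply: dominated01D; last exact: hd.
  by apply: IH => i ni; apply: hd; exact: leqW.
by apply/funext => s; rewrite big_nat_recr.
Qed.

Hypothesis Phi_measurable : Lmeasurable01 Phi.
Hypothesis Phi_ge0 : ae01 (fun s => 0 <= Phi s).
Hypothesis gPhi_L1 : mu.-integrable I01 (EFin \o (fun s => g s * Phi s)).

Let mI : measurable (I01 : set (LebR R)) := measurable_segment 0 1.

(** Only the product of [g] and [Phi] is known to be measurable. Where [Phi]
    vanishes every dominated function vanishes too, so under the integral [g]
    may be replaced by (g Phi) / Phi, which is measurable. The quotient is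
    written with the power function, whose value at the base 0 and the exponent
    -1 is 0. *)
Lemma dominated01_integrable h w : dominated01 h -> Lmeasurable01 w ->
  (exists M, ae01 (fun s => `|w s| <= M)) ->
  mu.-integrable I01 (EFin \o (fun s => h s * g s * w s)).
Proof.
move=> [mh [C hC]] mw [M wM].
have /measurable_EFinP mgP := measurable_int _ gPhi_L1.
have mv : Lmeasurable01 (fun s => Phi s `^ (-1)).
  rewrite /Lmeasurable01.
  apply: (@measurableT_comp _ _ _ _ _ _ (fun x : R => x `^ (-1))) => //.
have m : Lmeasurable01 (fun s => h s * (g s * Phi s * Phi s `^ (-1)) * w s).
  exact: (measurable_funM (measurable_funM mh (measurable_funM mgP mv)) mw).
have eqh : ae01 (fun s =>
    h s * (g s * Phi s * Phi s `^ (-1)) * w s = h s * g s * w s).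
  apply: ae01S2 hC Phi_ge0 => s _ hC; rewrite le_eqVlt => /predU1P[/esym Ps0|Ps0].
    move: hC; rewrite Ps0 mulr0 normr_le0 => /eqP ->.
    by rewrite !mul0r.
  by rewrite powR_inv1 ?ltW// mulfK ?gt_eqF.
have m' : Lmeasurable01 (fun s => h s * g s * w s).
  exact: (ae_eq_measurable completed_lebesgue_measure_is_complete eqh).
apply: (@ae_dominated_integrable _ _ R mu _ mI _
   (fun s => `|C| * `|M| * `|g s * Phi s|)) => //.
  apply: ae01S3 hC wM Phi_ge0 => s _ hC wM P0.
  rewrite !normrM.
  have -> : `|C| * `|M| * (`|g s| * `|Phi s|) =
     `|C| * `|Phi s| * `|g s| * `|M| by ring.
  apply: ler_pM => //.
    apply: ler_pM => //.
    by rewrite (le_trans hC)// -normrM ler_norm.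
  by rewrite (le_trans wM)// ler_norm.
have : mu.-integrable I01 (fun s => (`|C| * `|M|)%:E * `|(g s * Phi s)%:E|)%E.
  by apply: integrableZl => //; exact: (integrable_abse gPhi_L1).
by [].
Qed.

Lemma dominated01_integrable1 h : dominated01 h ->
  mu.-integrable I01 (EFin \o (fun s => h s * g s)).
Proof.
move=> hd; have := @dominated01_integrable h (fun=> 1) hd (measurable_cst _).
rewrite (_ : EFin \o (fun s => h s * g s * 1) = EFin \o (fun s => h s * g s)).
  by apply; exists 1; apply: aeW => s _; rewrite normr1.
by apply/funext => s /=; rewrite mulr1.
Qed.

Variables (k : R -> R -> R) (F : R -> R).
Hypothesis k_dominated : forall t, I01 t -> dominated01 (k t).
Hypothesis k_le_Phi : forall t, I01 t -> ae01 (fun s => `|k t s| <= Phi s).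
Hypothesis F_bv : bounded_variation 0 1 F.

Lemma dominated01_left_sum n : dominated01 (fun s => left_sum n (k^~ s) F).
Proof.
apply: dominated01_sum => i iLn.
rewrite (_ : (fun _ => _) = fun s =>
    (F (i.+1%:R / n.+1%:R) - F (i%:R / n.+1%:R)) * k (i%:R / n.+1%:R) s).
  by apply: dominated01Zl; apply: k_dominated; exact: left_tag01.
by apply/funext => s; rewrite mulrC.
Qed.

(** Countably many sections of [k] occur in the left sums, so one null set
    serves for the bounds on all of them. *)
Lemma left_sum_dominated : exists2 W : R, 0 <= W &
  ae01 (fun s => forall n, `|left_sum n (k^~ s) F| <= W * Phi s).
Proof.
have [W W0 HW] := left_sum_bound F_bv; exists W => //.
have : ae01 (fun s => forall n i : nat, (i <= n)%N ->
    `|k (i%:R / n.+1%:R) s| <= Phi s).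
  apply: ae01_foralln => n; apply: ae01_foralln => i.
  have [iLn|iLn] := boolP (i <= n)%N; last by apply: aeW.
  by apply: ae01S (k_le_Phi (left_tag01 iLn)).
by apply: ae01S => s _ ks n; apply: HW => i; exact: ks.
Qed.

Hypothesis kF_integrable : ae01 (fun s => RS_integrable01 (k ^~ s) F).

(** As an almost everywhere limit of left sums, [calK k F] inherits their
    measurability and their bound, which is uniform in [n]. *)
Lemma dominated01_calK : dominated01 (calK k F).
Proof.
have cv : ae01 (fun s => left_sum n (k^~ s) F @[n --> \oo] --> calK k F s).
  by apply: ae01S kF_integrable => s _; exact: RS01_cvg.
split.
  apply: (@ae_cvg_measurable _ (LebR R) R mu I01 completed_lebesgue_measure_is_complete
    (fun n s => left_sum n (k^~ s) F) _ _ cv).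
  by move=> n; have [] := dominated01_left_sum n.
have [W W0 HW] := left_sum_dominated; exists W.
apply: ae01S2 cv HW => s _ cv HW.
have nv : `|left_sum n (k^~ s) F| @[n --> \oo] --> `|calK k F s| by exact: cvg_norm.
rewrite -(cvg_lim (@Rhausdorff R) nv).
apply: limr_le; first by apply/cvg_ex; exists `|calK k F s|.
by apply: nearW.
Qed.

Lemma left_sum_Rintegral w n : Lmeasurable01 w ->
  (exists M, ae01 (fun s => `|w s| <= M)) ->
  left_sum n (fun t => \int[mu]_(s in I01) (k t s * g s * w s)) F =
  \int[mu]_(s in I01) (left_sum n (k^~ s) F * g s * w s).
Proof.
move=> mw wM.
pose c i := F (i.+1%:R / n.+1%:R) - F (i%:R / n.+1%:R).
pose G i s := c i * (k (i%:R / n.+1%:R) s * g s * w s).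
have Gi i : (i < n.+1)%N -> mu.-integrable I01 (EFin \o G i).
  move=> iLn; rewrite (_ : EFin \o G i =
      fun s => ((c i)%:E * (k (i%:R / n.+1%:R) s * g s * w s)%:E)%E)//.
  apply: integrableZl => //; apply: dominated01_integrable => //.
  by apply: k_dominated; exact: left_tag01.
transitivity (\sum_(0 <= i < n.+1) \int[mu]_(s in I01) G i s).
  rewrite /left_sum !big_mkord; apply: eq_bigr => -[i /= iLn] _.
  rewrite [LHS]mulrC RintegralZl//; apply: dominated01_integrable => //.
  by apply: k_dominated; exact: left_tag01.
rewrite -Rintegral_sum//; apply: eq_Rintegral => s _.
rewrite /left_sum !mulr_suml; apply: eq_bigr => i _.
by rewrite /G /c; ring.
Qed.

(** Interchange of the Stieltjes integral in [t] with the Lebesgue integral in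
    [s]: it is trivial for the left sums, which are finite, and
    [left_sum_dominated] provides the domination needed to pass to the limit. *)
Lemma RS01_Rintegral w : Lmeasurable01 w ->
  (exists M, ae01 (fun s => `|w s| <= M)) ->
  left_sum n (fun t => \int[mu]_(s in I01) (k t s * g s * w s)) F
    @[n --> \oo] --> \int[mu]_(s in I01) (calK k F s * g s * w s).
Proof.
move=> mw wM.
have lsi n : mu.-integrable I01 (EFin \o (fun s => left_sum n (k^~ s) F * g s * w s)).
  exact: dominated01_integrable (dominated01_left_sum n) mw wM.
have Ki : mu.-integrable I01 (EFin \o (fun s => calK k F s * g s * w s)).
  exact: dominated01_integrable dominated01_calK mw wM.
under eq_fun do rewrite left_sum_Rintegral//.
have [W W0 HW] := left_sum_dominated.
have [M HM] := wM.
apply: (@Rintegral_dominated_cvg _ _ R mu _ mI _ _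
   (fun s => W * `|M| * `|g s * Phi s|)).
- by move=> n; apply/measurable_EFinP; exact: measurable_int (lsi n).
- by apply/measurable_EFinP; exact: measurable_int Ki.
- apply: ae01S kF_integrable => s _ kF.
  by apply: cvgMl; apply: cvgMl; exact: RS01_cvg.
- have : mu.-integrable I01 (fun s => (W * `|M|)%:E * `|(g s * Phi s)%:E|)%E.
    by apply: integrableZl => //; exact: (integrable_abse gPhi_L1).
  by [].
- apply: ae01S3 HW HM Phi_ge0 => s _ HW HM P0 n.
  rewrite !normrM (ger0_norm P0).
  have -> : W * `|M| * (`|g s| * Phi s) = W * Phi s * `|g s| * `|M| by ring.
  apply: ler_pM => //.
    by apply: ler_pM => //; exact: HW.
  by rewrite (le_trans HM)// ler_norm.
Qed.

End Dominated.

(** * Reduction of the perturbed equation *)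

Section Perturbed.
Context {R : realType}.
Local Notation mu := (@completed_lebesgue_measure R).
Variables (Phi g gam del A B : R -> R) (k : R -> R -> R).
Hypothesis Phi_measurable : Lmeasurable01 Phi.
Hypothesis Phi_ge0 : ae01 (fun s => 0 <= Phi s).
Hypothesis gPhi_L1 : mu.-integrable I01 (EFin \o (fun s => g s * Phi s)).
Hypothesis k_dominated : forall t, I01 t -> dominated01 Phi (k t).
Hypothesis k_le_Phi : forall t, I01 t -> ae01 (fun s => `|k t s| <= Phi s).
Hypotheses (A_bv : bounded_variation 0 1 A) (B_bv : bounded_variation 0 1 B).
Hypothesis kA_integrable : ae01 (fun s => RS_integrable01 (k ^~ s) A).
Hypothesis kB_integrable : ae01 (fun s => RS_integrable01 (k ^~ s) B).
Hypotheses (gam_cont : C01 gam) (del_cont : C01 del).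
Hypothesis D_gt0 : 0 < detD A B gam del.

Let mI : measurable (I01 : set (LebR R)) := measurable_segment 0 1.

Lemma dominated01_kS t : I01 t -> dominated01 Phi (kS k A B gam del t).
Proof.
move=> It; rewrite /kS.
have dA : dominated01 Phi (calK k A) by exact: dominated01_calK.
have dB : dominated01 Phi (calK k B) by exact: dominated01_calK.
apply: dominated01D; last exact: k_dominated.
by apply: dominated01D; apply: dominated01Zl; apply: dominated01D;
  exact: dominated01Zl.
Qed.

(** All four Stieltjes integrals are limits of left sums, which are linear. *)
Lemma RS01_perturbed (F u w : R -> R) (p q : R) :
  bounded_variation 0 1 F -> ae01 (fun s => RS_integrable01 (k ^~ s) F) ->
  C01 u -> Lmeasurable01 w -> (exists M, ae01 (fun s => `|w s| <= M)) ->
  (forall t, I01 t -> u t = gam t * p + del t * q +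
     \int[mu]_(s in I01) (k t s * g s * w s)) ->
  RS01 u F = p * RS01 gam F + q * RS01 del F +
     \int[mu]_(s in I01) (calK k F s * g s * w s).
Proof.
move=> F_bv kF uc mw wM uE.
have cu := RS01_cvg (RS_integrable_continuous uc F_bv).
have cgam := RS01_cvg (RS_integrable_continuous gam_cont F_bv).
have cdel := RS01_cvg (RS_integrable_continuous del_cont F_bv).
have cFu := RS01_Rintegral Phi_measurable Phi_ge0 gPhi_L1 k_dominated k_le_Phi
  F_bv kF mw wM.
have cv := cvgD (cvgD (cvgM (cvg_cst p) cgam) (cvgM (cvg_cst q) cdel)) cFu.
apply: (@cvg_unique _ (@Rhausdorff R) _ _ _ _ cu).
rewrite (_ : (fun n => left_sum n u F) = fun n =>
  p * left_sum n gam F + q * left_sum n del F +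
  left_sum n (fun t => \int[mu]_(s in I01) (k t s * g s * w s)) F);
  first exact: cv.
apply/funext => n; rewrite /left_sum !mulr_sumr -!big_split /=.
rewrite !big_mkord; apply: eq_bigr => -[i /= iLn] _.
rewrite (uE _ (@left_tag01 R n i iLn)); ring.
Qed.

(** Applying the two functionals to the equation gives a linear system for
    their values at [u], with determinant [detD]. Solving it expresses the
    boundary terms through the integrals of [calK k A] and [calK k B], and these
    are the terms by which [kS] differs from [k]. *)
Lemma solves_perturbed_kS f u :
  Lmeasurable01 (fun s => f s (u s)) ->
  (exists M, ae01 (fun s => `|f s (u s)| <= M)) -> C01 u ->
  solves_perturbed k g f A B gam del u -> solves_kS k g f A B gam del u.
Proof.
move=> mw wM uc uE t It; rewrite (uE t It).
have EA := RS01_perturbed A_bv kA_integrable uc mw wM uE.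
have EB := RS01_perturbed B_bv kB_integrable uc mw wM uE.
have dA : dominated01 Phi (calK k A) by exact: dominated01_calK.
have dB : dominated01 Phi (calK k B) by exact: dominated01_calK.
have int h : dominated01 Phi h ->
    mu.-integrable I01 (EFin \o (fun s => h s * g s * f s (u s))).
  by move=> hd; apply: (dominated01_integrable Phi_measurable).
set D := detD A B gam del.
pose x := gam t / D * (1 - RS01 del B) + del t / D * RS01 gam B.
pose y := gam t / D * RS01 del A + del t / D * (1 - RS01 gam A).
have -> : \int[mu]_(s in I01) (kS k A B gam del t s * g s * f s (u s)) =
    x * \int[mu]_(s in I01) (calK k A s * g s * f s (u s)) +
    y * \int[mu]_(s in I01) (calK k B s * g s * f s (u s)) +
    \int[mu]_(s in I01) (k t s * g s * f s (u s)).
  rewrite -!RintegralZl//; try exact: int.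
  have iA := integrableZl mI x (int _ dA).
  have iB := integrableZl mI y (int _ dB).
  have iAB := integrableD mI iA iB.
  rewrite -RintegralD// -RintegralD//; last by apply/int/k_dominated.
  by apply: eq_Rintegral => s _; rewrite /kS -/D /x /y; ring.
congr (_ + _).
set IA := \int[mu]_(s in I01) (calK k A s * _ * _) in EA *.
set IB := \int[mu]_(s in I01) (calK k B s * _ * _) in EB *.
set p := RS01 u A in EA EB *; set q := RS01 u B in EA EB *.
have -> : IA = p - (p * RS01 gam A + q * RS01 del A) by rewrite {1}EA; ring.
have -> : IB = q - (p * RS01 gam B + q * RS01 del B) by rewrite {1}EB; ring.
rewrite /x /y; move: D_gt0; rewrite -/D => /lt0r_neq0; rewrite /D /detD => D0.
by field.
Qed.

End Perturbed.

(** * Nonexistence of solutions *)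

Section NoSolution.
Context {R : realType}.
Local Notation mu := (@completed_lebesgue_measure R).
Variables (Phi g : R -> R) (kap f : R -> R -> R) (u : R -> R).
Hypothesis Phi_measurable : Lmeasurable01 Phi.
Hypothesis Phi_ge0 : ae01 (fun s => 0 <= Phi s).
Hypothesis gPhi_L1 : mu.-integrable I01 (EFin \o (fun s => g s * Phi s)).
Hypothesis g_ge0 : ae01 (fun s => 0 <= g s).
Hypothesis kap_dominated : forall t, I01 t -> dominated01 Phi (kap t).
Hypothesis f_ge0 : forall t v, I01 t -> 0 <= f t v.
Hypothesis f_carath : caratheodory f.
Hypothesis u_cont : C01 u.
Hypothesis u_nontrivial : nontrivial01 u.
Hypothesis u_solution : forall t, I01 t ->
  u t = \int[mu]_(s in I01) (kap t s * g s * f s (u s)).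

Let mI : measurable (I01 : set (LebR R)) := measurable_segment 0 1.

Let fu_measurable : Lmeasurable01 (fun s => f s (u s)).
Proof. by have [mf cf _] := f_carath; exact: Lmeasurable_superposition. Qed.

Let fu_bounded : exists M, ae01 (fun s => `|f s (u s)| <= M).
Proof. exact: superposition_bounded. Qed.

Let weight_integrable h : dominated01 Phi h ->
  mu.-integrable I01 (EFin \o (fun s => h s * g s)).
Proof. exact: (dominated01_integrable1 Phi_measurable). Qed.

Let source_integrable h : dominated01 Phi h ->
  mu.-integrable I01 (EFin \o (fun s => h s * g s * f s (u s))).
Proof.
by move=> hd; apply: (dominated01_integrable Phi_measurable).
Qed.

(** At a point where |u| is maximal, say of value N, the number |u| is at most
    the integral of [kap^+ g f(., u)] or of [kap^- g f(., u)]. Almost everywhere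
    f(s, u(s)) < m N strictly, including where [u] vanishes, so either the
    weight vanishes almost everywhere or the integral is strictly smaller than
    m N times that of the weight, which is at most 1 / m. Both give N < N. *)
Lemma not_solution_sublinear :
  (forall t v, I01 t -> v != 0 ->
     f t v < (sup [set Num.max
         (\int[mu]_(s in I01) (Num.max (kap t s) 0 * g s))
         (\int[mu]_(s in I01) (Num.max (- kap t s) 0 * g s))
       | t in I01])^-1 * `|v|) -> False.
Proof.
set S := [set _ | _ in _]; set m := _^-1 => fm.
have I0 : I01 (0 : R) by rewrite /= in_itv/= lexx ler01.
have m0 : 0 < m.
  have := fm 0 1 I0 (oner_neq0 _); rewrite normr1 mulr1.
  by apply: le_lt_trans; exact: f_ge0.
(* an empty or unbounded set has supremum 0 by convention, so positivity of the
   supremum also yields boundedness of S *)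
have S0 : 0 < sup S by rewrite -invr_gt0.
have hS : has_sup S.
  by apply: contrapT => /sup_out S00; move: S0; rewrite S00 ltxx.
have [t0 It0 maxu] := C01_max_norm u_cont.
pose N := `|u t0|.
have N0 : 0 < N.
  have [t It ut] := u_nontrivial; apply: lt_le_trans (maxu t It).
  by rewrite normr_gt0.
have fuN : ae01 (fun s => f s (u s) < m * N).
  have [_ cf _] := f_carath.
  apply: ae01S cf => s Is cfs.
  have [us0|us0] := eqVneq (u s) 0; last first.
    by apply: lt_le_trans (fm _ _ Is us0) _; rewrite ler_pM2l// maxu.
  (* at 0 the bound on f s passes to the limit: f s 0 <= 0 *)
  rewrite us0; apply: le_lt_trans (mulr_gt0 m0 N0).
  rewrite leNgt; apply/negP => fs0.
  have fs20 : 0 < f s 0 / 2 by rewrite divr_gt0.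
  have /cvgrPdist_lt /(_ _ fs20) [d /= d0 dP] := cfs 0.
  pose v := Num.min (d / 2) (f s 0 / 2 / m).
  have v0 : 0 < v by rewrite lt_min !divr_gt0.
  have vd : v < d.
    by rewrite /v gt_min; apply/orP; left; rewrite ltr_pdivrMr// ltr_pMr// ltr1n.
  have mv : m * v <= f s 0 / 2.
    by rewrite mulrC -ler_pdivlMr// /v ge_min lexx orbT.
  have := fm s v Is (lt0r_neq0 v0); rewrite gtr0_norm// => fv.
  have : `|f s 0 - f s v| < f s 0 / 2.
    by apply: dP; rewrite /ball_ /= sub0r normrN gtr0_norm.
  by rewrite ltr_norml; lra.
have below P : dominated01 Phi P -> (forall s, 0 <= P s) ->
    \int[mu]_(s in I01) (P s * g s) <= sup S ->
    \int[mu]_(s in I01) (P s * g s * f s (u s)) < N.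
  move=> Pd P0 PS.
  have [Pg0|Pgn0] := pselect (ae01 (fun s => P s * g s = 0)).
    rewrite (_ : Rintegral _ _ _ = 0)//.
    apply: (@ae_eq0_Rintegral _ (LebR R) R mu I01 mI (fun s => P s * g s * f s (u s))).
      by apply/measurable_EFinP; exact: measurable_int (source_integrable Pd).
    by apply: ae01S Pg0 => s _ ->; rewrite mul0r.
  have -> : N = sup S * (m * N) by rewrite /m mulrA divff ?mul1r// gt_eqF.
  apply: (@lt_le_trans _ _ (\int[mu]_(s in I01) (P s * g s * (m * N)))).
    apply: (@ae_weighted_Rintegral_lt _ (LebR R)) => //.
    - exact: source_integrable.
    - apply: (dominated01_integrable Phi_measurable) => //.
        exact: measurable_cst.
      by exists `|m * N|; apply: aeW.
    - by apply: ae01S g_ge0 => s _ gs; rewrite mulr_ge0.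
  rewrite RintegralZr//; last exact: weight_integrable.
  by rewrite ler_pM2r// mulr_gt0.
have inS t P : I01 t ->
    P = (fun s => Num.max (kap t s) 0) \/ P = (fun s => Num.max (- kap t s) 0) ->
    \int[mu]_(s in I01) (P s * g s) <= sup S.
  move=> It PE; apply: le_trans (ub_le_sup hS.2 _); last by exists t => //; reflexivity.
  by rewrite le_max; case: PE => ->; rewrite lexx ?orbT.
have Nkap_d : dominated01 Phi (fun s => - kap t0 s).
  rewrite (_ : (fun _ => _) = (fun s => -1 * kap t0 s)).
    by apply: dominated01Zl; exact: kap_dominated.
  by apply/funext => s; rewrite mulN1r.
have kap_d := kap_dominated It0.
have max0_ge0 (h : R -> R) s : 0 <= Num.max (h s) 0 by rewrite le_max lexx orbT.
have utN : u t0 < N.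
  rewrite (u_solution It0).
  apply: le_lt_trans (below _ (dominated01_max0 kap_d)
    (max0_ge0 (kap t0)) (inS _ _ It0 (or_introl erefl))).
  apply: ae_le_Rintegral => //.
  - exact: source_integrable.
  - exact: source_integrable (dominated01_max0 kap_d).
  - apply: ae01S g_ge0 => s Is gs.
    by rewrite !ler_wpM2r ?f_ge0// le_max lexx.
have uNt : - u t0 < N.
  rewrite (u_solution It0) -mulN1r -RintegralZl//; last exact: source_integrable.
  apply: le_lt_trans (below _ (dominated01_max0 Nkap_d)
    (max0_ge0 (fun s => - kap t0 s)) (inS _ _ It0 (or_intror erefl))).
  apply: ae_le_Rintegral => //.
  - exact: (integrableZl mI (-1) (source_integrable kap_d)).
  - exact: source_integrable (dominated01_max0 Nkap_d).
  - apply: ae01S g_ge0 => s Is gs.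
    rewrite mulN1r -!mulNr.
    by rewrite !ler_wpM2r ?f_ge0// le_max lexx.
have : N < N by rewrite {1}/N ltr_norml ltrNl utN uNt.
by rewrite ltxx.
Qed.

Variables (a b c c1 : R).
Hypothesis ab01 : [/\ 0 <= a, a <= b & b <= 1].
Hypothesis c_gt0 : 0 < c.
Hypothesis c1_gt0 : 0 < c1.
Hypothesis kap_ge_Phi : forall t, `[a, b]%classic t ->
  ae01 (fun s => c1 * Phi s <= kap t s).
Hypothesis gPhi_gt0 : 0 < \int[mu]_(s in `[a, b]) (Phi s * g s).
Hypothesis u_cone : c * norm01 u <= inf [set u t | t in `[a, b]].

Let ab_sub : `[a, b]%classic `<=` (I01 : set R).
Proof.
have [a0 _ b1] := ab01; move=> t /=; rewrite !in_itv/= => /andP[at_ tb].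
by rewrite (le_trans a0)// (le_trans tb).
Qed.

Let mJ : measurable (`[a, b]%classic : set (LebR R)) := measurable_segment a b.

Let ae_sub (P : R -> Prop) : ae01 P ->
  {ae mu, forall s, `[a, b]%classic s -> P s}.
Proof. by rewrite /ae01; apply: filterS => s + abs; apply; exact: ab_sub. Qed.

Lemma cone_min : exists t1, [/\ `[a, b]%classic t1, 0 < u t1 &
  forall t, `[a, b]%classic t -> u t1 <= u t].
Proof.
have [a0 ab b1] := ab01.
have uab : {within `[a, b], continuous u}.
  exact: continuous_subspaceW u_cont.
have [t1 t1ab t1P] := EVT_min ab uab.
exists t1; split => //.
have [t0 It0 maxu] := C01_max_norm u_cont.
have u0 : 0 < norm01 u.
  have [t It ut] := u_nontrivial.
  apply: (@lt_le_trans _ _ `|u t|); first by rewrite normr_gt0.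
  apply: ub_le_sup; last by exists t.
  by exists `|u t0| => _ [s Is <-]; exact: maxu.
apply: (@lt_le_trans _ _ (c * norm01 u)); first exact: mulr_gt0.
apply: le_trans u_cone _; apply: ge_inf; last by exists t1.
by exists (u t1) => _ [s Is <-]; exact: t1P.
Qed.

(** Let u(t1) be the minimum of [u] on [a, b], which is positive by the cone
    condition. The integral over [0, 1] that gives u(t1) has a nonnegative
    integrand, and on [a, b] one has f(s, u(s)) > M u(s) >= M u(t1), so that it
    exceeds M u(t1) times the integral of [kap t1 * g] over [a, b], hence u(t1)
    itself. *)
Lemma not_solution_superlinear :
  (forall t v, `[a, b]%classic t -> 0 < v ->
     (inf [set \int[mu]_(s in `[a, b]) (kap t s * g s) | t in `[a, b]])^-1 * v
       < f t v) -> False.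
Proof.
set S := [set _ | _ in _]; set M := _^-1 => fM.
have [t1 [t1ab ut1 t1P]] := cone_min.
have It1 := ab_sub t1ab.
have Phi_d : dominated01 Phi Phi.
  split => //; exists 1; apply: ae01S Phi_ge0 => s _ P0.
  by rewrite ger0_norm// mul1r.
have iJ (h : R -> R) : mu.-integrable I01 (EFin \o h) ->
  mu.-integrable `[a, b] (EFin \o h).
  exact: integrableS.
have kap_ge0 t : `[a, b]%classic t -> ae01 (fun s => 0 <= kap t s).
  move=> abt; apply: ae01S2 (kap_ge_Phi abt) Phi_ge0 => s _ + P0.
  by apply: le_trans; rewrite mulr_ge0// ltW.
(* L keeps the infimum defining M away from 0 *)
pose L := c1 * \int[mu]_(s in `[a, b]) (Phi s * g s).
have L0 : 0 < L by rewrite mulr_gt0.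
have LS t : `[a, b]%classic t ->
    L <= \int[mu]_(s in `[a, b]) (kap t s * g s).
  move=> abt; rewrite /L -RintegralZl//; last by apply: iJ; exact: weight_integrable.
  apply: ae_le_Rintegral => //.
  - exact: (integrableZl mJ c1 (iJ _ (weight_integrable Phi_d))).
  - by apply: iJ; apply: weight_integrable; exact/kap_dominated/ab_sub.
  - apply: ae_sub; apply: ae01S2 (kap_ge_Phi abt) g_ge0 => s _ kP gs.
    by rewrite mulrA ler_wpM2r.
have LI : L <= inf S.
  apply: lb_le_inf; first by exists (\int[mu]_(s in `[a, b]) (kap t1 s * g s)), t1.
  by move=> _ [t abt <-]; exact: LS.
have S0 : 0 < inf S by exact: lt_le_trans LI.
have M0 : 0 < M by rewrite invr_gt0.
have IS : inf S <= \int[mu]_(s in `[a, b]) (kap t1 s * g s).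
  apply: ge_inf; last by exists t1.
  by exists L => _ [t abt <-]; exact: LS.
have kap_d := kap_dominated It1.
have lt1 : u t1 < \int[mu]_(s in `[a, b]) (kap t1 s * g s * f s (u s)).
  apply: (@le_lt_trans _ _
      (\int[mu]_(s in `[a, b]) (kap t1 s * g s * (M * u t1)))).
    rewrite RintegralZr//; last by apply: iJ; exact: weight_integrable.
    rewrite mulrA -[leLHS]mul1r ler_pM2r// -(@mulfV _ (inf S)) ?gt_eqF//.
    by rewrite ler_pM2r.
  apply: (@ae_weighted_Rintegral_lt _ (LebR R)) => //.
  - apply: iJ; apply: (dominated01_integrable Phi_measurable) => //.
        exact: measurable_cst.
    by exists `|M * u t1|; apply: aeW.
  - by apply: iJ; exact: source_integrable.
  - apply: ae_sub; apply: ae01S2 g_ge0 (kap_ge0 _ t1ab) => s _ gs ks.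
    exact: mulr_ge0.
  - apply: aeW => s abs; have us : 0 < u s by exact: lt_le_trans (t1P s abs).
    by apply: le_lt_trans (fM s (u s) abs us); rewrite ler_pM2l// t1P.
  - move=> kg0; have : 0 < \int[mu]_(s in `[a, b]) (kap t1 s * g s).
      exact: lt_le_trans IS.
    rewrite (_ : Rintegral _ _ _ = 0) ?ltxx//.
    apply: (@ae_eq0_Rintegral _ (LebR R) R mu _ mJ (fun s => kap t1 s * g s) _ kg0).
    by apply/measurable_EFinP; exact: measurable_int (iJ _ (weight_integrable kap_d)).
have : u t1 < u t1.
  apply: lt_le_trans lt1 _; rewrite [leRHS](u_solution It1).
  apply: ae_Rintegral_subset => //; first exact: source_integrable.
  apply: ae01S2 g_ge0 (kap_ge0 _ t1ab) => s Is gs ks.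
  by rewrite !mulr_ge0// f_ge0.
by rewrite ltxx.
Qed.

End NoSolution.

Theorem theorem3p3 (R : realType) (k f : R -> R -> R)
    (g gam del A B Phi : R -> R) (a b c1 c2 c3 : R)
    (* (C1) *)
    (k_measurable : Lmeasurable01x01 k)
    (k_lim : forall tau, I01 tau ->
       ae01 (fun s =>
         `|k t s - k tau s| @[t --> within I01 (nbhs tau)] --> (0 : R)))
    (* (C2) *)
    (ab01 : [/\ 0 <= a, a <= b & b <= 1])
    (Phi_Linfty : Linfty01 Phi)
    (c1_bounds : 0 < c1 <= 1)
    (k_le_Phi : forall t, I01 t -> ae01 (fun s => `|k t s| <= Phi s))
    (k_ge_Phi : forall t, `[a, b]%classic t ->
       ae01 (fun s => c1 * Phi s <= k t s))
    (* (C3) *)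
    (gPhi_L1 : leb.-integrable I01 (EFin \o (fun s => g s * Phi s)))
    (g_ge0 : ae01 (fun s => 0 <= g s))
    (gPhi_gt0 : 0 < \int[leb]_(s in `[a, b]) (Phi s * g s))
    (* (C4) *)
    (f_ge0 : forall t u, I01 t -> 0 <= f t u)
    (f_carath : caratheodory f)
    (* (C5) *)
    (A_bv : bounded_variation 0 1 A)
    (B_bv : bounded_variation 0 1 B)
    (KA_ge0 : ae01 (fun s => RS_integrable01 (k ^~ s) A /\ 0 <= calK k A s))
    (KB_ge0 : ae01 (fun s => RS_integrable01 (k ^~ s) B /\ 0 <= calK k B s))
    (* (C6) *)
    (gam_cont : C01 gam)
    (alpha_gam : 0 <= RS01 gam A < 1)
    (beta_gam : 0 <= RS01 gam B)
    (c2_bounds : 0 < c2 <= 1)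
    (gam_ge : forall t, `[a, b]%classic t -> c2 * norm01 gam <= gam t)
    (* (C7) *)
    (del_cont : C01 del)
    (beta_del : 0 <= RS01 del B < 1)
    (alpha_del : 0 <= RS01 del A)
    (c3_bounds : 0 < c3 <= 1)
    (del_ge : forall t, `[a, b]%classic t -> c3 * norm01 del <= del t)
    (* (C8) *)
    (D_gt0 : 0 < detD A B gam del)
    (f_mS_MS :
       (forall t u, I01 t -> u != 0 -> f t u < mS k g A B gam del * `|u|)
       \/
       (forall t u, `[a, b]%classic t -> 0 < u ->
          MS k g A B gam del a b * u < f t u)) :
  let c := Num.min c1 (Num.min c2 c3) in
  (~ exists u : R -> R, [/\ coneK A B a b c u, nontrivial01 u &
       solves_perturbed k g f A B gam del u]) /\
  (~ exists u : R -> R, [/\ coneK A B a b c u, nontrivial01 u &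
       solves_kS k g f A B gam del u]).
Proof.
move=> c.
have c10 : 0 < c1 by case/andP: c1_bounds.
have c0 : 0 < c.
  case/andP: c2_bounds => c20 _; case/andP: c3_bounds => c30 _.
  by rewrite !lt_min c10 c20.
have [a0 ab b1] := ab01.
have ab_sub t : `[a, b]%classic t -> I01 t.
  rewrite /= !in_itv/= => /andP[at_ tb].
  by rewrite (le_trans a0)// (le_trans tb).
have Phi_measurable := Linfty01_measurable Phi_Linfty.
have Phi_ge0 : ae01 (fun s => 0 <= Phi s).
  have I0 : I01 (0 : R) by rewrite /= in_itv/= lexx ler01.
  by apply: ae01S (k_le_Phi 0 I0) => s _; exact: le_trans.
have k_dominated t : I01 t -> dominated01 Phi (k t).
  move=> It; split; first exact: Lmeasurable_section.
  by exists 1; apply: ae01S (k_le_Phi t It) => s _; rewrite mul1r.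
have kA : ae01 (fun s => RS_integrable01 (k ^~ s) A).
  by apply: ae01S KA_ge0 => s _ [].
have kB : ae01 (fun s => RS_integrable01 (k ^~ s) B).
  by apply: ae01S KB_ge0 => s _ [].
have kS_dominated t : I01 t -> dominated01 Phi (kS k A B gam del t).
  exact: dominated01_kS.
have norm_ge0 (w : R -> R) : 0 <= norm01 w.
  (* the supremum is 0 by convention when it does not exist *)
  rewrite /norm01; have [hs|/sup_out->//] := pselect (has_sup [set `|w t| | t in I01]).
  have [[_ [t It _]] _] := hs; apply: (@le_trans _ _ `|w t|) => //.
  by apply: ub_le_sup; [exact: hs.2|exists t].
(* on [a, b] all terms added to k in kS are nonnegative *)
have kS_ge_Phi t : `[a, b]%classic t ->
    ae01 (fun s => c1 * Phi s <= kS k A B gam del t s).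
  move=> abt; apply: ae01S3 (k_ge_Phi t abt) KA_ge0 KB_ge0.
  move=> s _ kP [_ KAs] [_ KBs]; apply: le_trans kP _.
  rewrite /kS lerDr.
  have gt0 : 0 <= gam t.
    by apply: le_trans (gam_ge t abt); rewrite mulr_ge0// ltW//; case/andP: c2_bounds.
  have dt0 : 0 <= del t.
    by apply: le_trans (del_ge t abt); rewrite mulr_ge0// ltW//; case/andP: c3_bounds.
  case/andP: alpha_gam => _ /ltW ag1; case/andP: beta_del => _ /ltW bd1.
  by apply: addr_ge0; apply: mulr_ge0; rewrite ?divr_ge0 ?(ltW D_gt0)//;
    apply: addr_ge0; apply: mulr_ge0; rewrite ?subr_ge0.
have no_kS u : coneK A B a b c u -> nontrivial01 u ->
    solves_kS k g f A B gam del u -> False.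
  move=> [uc ucone _ _] un us.
  case: f_mS_MS => fm.
    exact: (not_solution_sublinear Phi_measurable Phi_ge0 gPhi_L1 g_ge0
      kS_dominated f_ge0 f_carath uc un us fm).
  exact: (not_solution_superlinear Phi_measurable Phi_ge0 gPhi_L1 g_ge0
    kS_dominated f_ge0 f_carath uc un us ab01 c0 c10 kS_ge_Phi gPhi_gt0 ucone fm).
split=> -[u [uK un us]]; apply: (no_kS u uK un) => //.
have [uc _ _ _] := uK; have [mf cf _] := f_carath.
apply: (solves_perturbed_kS Phi_measurable Phi_ge0 gPhi_L1) => //.
  exact: Lmeasurable_superposition.
exact: superposition_bounded.
Qed.
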